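(* Let $\Gamma=(P,\mathcal{L})$ be a point-line geometry satisfying the Exchange Property (EP). Then all maximal well ordered chains of subspaces of $\Gamma$ have length equal to $\mathrm{rk}(\Gamma)$.
   Context: A point-line geometry is a pair $\Gamma=(P,\mathcal{L})$ where $P$ (points) is a non-empty set and $\mathcal{L}$ (lines) is a family of subsets of $P$, each containing at least two points. A subspace of $\Gamma$ is a subset $S\subseteq P$ such that every line meeting $S$ in at least two points is contained in $S$ (so $\emptyset$ and $P$ are subspaces). For $X\subseteq P$, $\langle X\rangle$ is the smallest subspace containing $X$. Exchange Property (EP): for all $X\subseteq P$ and $x,y\in P$, if $y\in\langle X\cup\{x\}\rangle$ but $y\notin\langle X\rangle$, then $x\in\langle X\cup\{y\}\rangle$. When (EP) holds, the rank of $\Gamma$ is $\mathrm{rk}(\Gamma):=\min\{|X| : X\subseteq P,\ \langle X\rangle=P\}$, which equals the cardinality of any minimal generating set. A chain of subspaces is a set $\mathcal{C}$ of subspaces totally ordered by inclusion; its length is $\ell(\mathcal{C}):=|\mathcal{C}|-1$, with $|\mathcal{C}|-1=|\mathcal{C}|$ if $|\mathcal{C}|$ is infinite. A maximal well ordered chain is a chain well ordered by inclusion that is maximal (with respect to inclusion of chains as sets of subspaces) among all well ordered chains of subspaces of $\Gamma$. *)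

(* Defs.v *)
From mathcomp Require Import all_boot all_order finmap.
From mathcomp Require Import boolp classical_sets functions cardinality wochoice.

Set Implicit Arguments.
Unset Strict Implicit.
Unset Printing Implicit Defensive.

Local Open Scope classical_set_scope.
Local Open Scope card_scope.

(* Cardinal numbers in the style of Frege: the cardinal of a set, possibly
   infinite, is the class of all types equinumerous to it.  This makes equality
   of cardinals of sets over different types (points, subspaces, naturals)
   meaningful; see [cardinal_of_eq]. *)
Definition cardinal := Type -> Prop.

Definition cardinal_of (T : Type) (A : set T) : cardinal :=
  fun U => [set: U] #= A.

Lemma cardinal_of_eq (T U : Type) (A : set T) (B : set U) :
  cardinal_of A = cardinal_of B <-> A #= B.
Proof.
split=> [/(congr1 (fun k => k (set_type A))) AB | AB].
  have /card_esym AA : [set: set_type A] #= A by exact: card_setT.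
  by apply: card_eq_trans AA _;
    move: AB; rewrite /cardinal_of => <-; exact: card_setT.
apply/funext => V; apply/propext; split=> VA; apply: card_eq_trans VA _ => //.
exact: card_esym.
Qed.

Record point_line_geometry := Geometry {
  points : Type;
  lines : set (set points);
  points_nonempty : [set: points] !=set0;
  line_ge2 : forall L, lines L -> exists x y, [/\ L x, L y & x <> y]
}.

Section Geometry.
Variable G : point_line_geometry.
Implicit Types (S X Y : set (points G)) (C D : set (set (points G))).

Definition is_subspace S : Prop :=
  forall L, lines L ->
    (exists x y, [/\ (L `&` S) x, (L `&` S) y & x <> y]) -> L `<=` S.

Definition span X : set (points G) := smallest is_subspace X.

Definition exchange_property : Prop :=
  forall X (x y : points G),
    span (X `|` [set x]) y -> ~ span X y -> span (X `|` [set y]) x.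

Definition generating X : Prop := span X = [set: points G].

(* The cardinal min {|X| : X generating}, as the cardinal of any generating set
   that is smallest for the comparison of cardinalities; see [rankE].  If no such
   set existed, [rank] would be the empty class, which is not a cardinal and
   differs from every [cardinal_of A]. *)
Definition rank : cardinal := fun U =>
  exists X, [/\ generating X, (forall Y, generating Y -> X #<= Y)
    & cardinal_of X U].

Lemma rankE X :
  generating X -> (forall Y, generating Y -> X #<= Y) -> rank = cardinal_of X.
Proof.
move=> gX minX; apply/funext => U; apply/propext; split=> [[Y [gY minY]]|].
  suff /cardinal_of_eq -> : X #= Y by [].
  by rewrite card_eq_le minX ?minY.
by exists X.
Qed.

(* On sets of points, [<=%O] is inclusion. *)
Definition subspace_chain C : Prop :=
  C `<=` is_subspace /\ chain <=%O (mem C).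

Definition well_ordered_chain C : Prop :=
  subspace_chain C /\ wo_chain <=%O (mem C).

Definition maximal_well_ordered_chain C : Prop :=
  well_ordered_chain C /\
  forall D, well_ordered_chain D -> C `<=` D -> D = C.

(* |C| - 1, with |C| - 1 = |C| for infinite C.  The only spurious value is
   0 on the empty chain, which is never maximal. *)
Definition chain_length C : cardinal :=
  if `[< finite_set C >] then cardinal_of `I_(#|` fset_set C|.-1)
  else cardinal_of C.

Lemma well_ordered_chainP C :
  well_ordered_chain C <->
  [/\ C `<=` is_subspace,
      (forall S T, C S -> C T -> S `<=` T \/ T `<=` S)
    & forall D, D `<=` C -> D !=set0 ->
        exists S, D S /\ forall T, D T -> S `<=` T].
Proof.
split=> [[[Csub Cch] Cwo]|[Csub Cch Cwo]]; split=> //.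
- move=> S T CS CT.
  have := Cch S T; rewrite !in_setE => /(_ CS CT) /orP[]; rewrite subsetEset;
  by [left|right].
- move=> D DC [S DS]; have [||M [[DM minM] _]] := Cwo (mem D).
  + by move=> T; rewrite !in_setE; exact: DC.
  + by exists S; apply/mem_set.
  exists M; split; first by move: DM; rewrite in_setE.
  by move=> T DT; rewrite -subsetEset; apply: minM; rewrite in_setE.
- split=> // S T; rewrite !in_setE => CS CT.
  by apply/orP; case: (Cch _ _ CS CT) => ?; [left|right]; rewrite subsetEset.
move=> A AC [S AS]; have [||M [AM minM]] := Cwo [set T | T \in A].
- by move=> T /= /AC; rewrite in_setE.
- by exists S.
exists M; split.
  by split=> // T AT; rewrite subsetEset; exact: minM.
move=> N [AN minN]; apply/seteqP; split; first exact: minM.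
by rewrite -subsetEset; exact: minN.
Qed.

End Geometry.

(* Main.v *)
Require Import Defs.
From mathcomp Require Import all_boot boolp classical_sets.
From mathcomp Require Import finmap functions cardinality.

(** The span of the union of a chain of sets is the union of their spans, so
    under (EP) an independent generating set is a generating set of least
    cardinality.  A well ordered chain [C] that is maximal contains every
    subspace comparable with all of its members.  So each [S] in [C] other than
    the whole space has as its successor the span of [S] and any one point [x S]
    of the successor outside [S], and limit members of [C] are unions of smaller
    members.  Transfinite induction along [C] shows that the points [x S]
    generate and, by (EP), that they are independent.  They are indexed
    injectively by [C] minus its top. *)

Set Implicit Arguments.
Unset Strict Implicit.
Unset Printing Implicit Defensive.

Local Open Scope classical_set_scope.
Local Open Scope card_scope.

(** * Comparing cardinalities through injections *)

Section Cardinality.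

Lemma card_le_inj (T U : Type) (A : set T) (B : set U) (f : T -> U) :
  (forall x, A x -> B (f x)) ->
  (forall x y, A x -> A y -> f x = f y -> x = y) -> A #<= B.
Proof.
move=> fAB finj; have /card_esym/card_eqPle[/card_le_trans + _] : f @` A #= A.
  by apply: inj_card_eq => x y; rewrite !in_setE; exact: finj.
by apply; apply: subset_card_le => _ [x Ax <-]; exact: fAB.
Qed.

(* Hilbert's hotel *)
Lemma infinite_card_setD1 (T : Type) (A : set T) (a : T) :
  infinite_set A -> A `\ a #= A.
Proof.
move=> Ainf; rewrite card_eq_le subset_card_le//=.
have : infinite_set (A `\ a) by apply: infinite_setD.
move=> /infiniteP/card_leP[f].
pose g n : T := val (f (SigSub (mem_set (I : [set: nat] n)))).
have gA n : (A `\ a) (g n) by exact: set_valP.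
have ginj m n : g m = g n -> m = n.
  by move=> /val_inj/(@inj _ _ _ f); rewrite !in_setT => /(_ isT isT) [].
pose h x := if pselect (exists n, x = g n) is left e then g (sval (cid e)).+1
            else if pselect (x = a) then g 0 else x.
have hg n : h (g n) = g n.+1.
  rewrite /h; case: pselect => [e|[]]; last by exists n.
  by case: cid => m /= /ginj ->.
have ha : h a = g 0.
  rewrite /h; case: pselect => [[n an]|_]; last by case: pselect.
  by have [_ []] := gA n.
have hx x : ~ (exists n, x = g n) -> x <> a -> h x = x.
  by rewrite /h => ng na; case: pselect => // _; case: pselect.
have caseP x : [\/ exists n, x = g n, x = a |
    [/\ ~ (exists n, x = g n), x <> a & h x = x]].
  have [ex|ex] := pselect (exists n, x = g n); first exact: Or31.
  have [xa|xa] := pselect (x = a); first exact: Or32.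
  by apply: Or33; split => //; exact: hx.
apply: (@card_le_inj _ _ _ _ h) => [x Ax|x y Ax Ay].
  by case: (caseP x) => [[n ->]|->|[_ xa ->]]; rewrite ?hg ?ha.
case: (caseP x) => [[n ->]|->|[xg xa ->]];
  case: (caseP y) => [[m ->]|->|[yg ya ->]];
  rewrite ?hg ?ha //.
- by move=> /ginj [->].
- by move=> /ginj.
- by move=> e; case: yg; exists n.+1.
- by move=> /ginj.
- by move=> e; case: yg; exists 0.
- by move=> e; case: xg; exists m.+1.
- by move=> e; case: xg; exists 0.
Qed.

End Cardinality.

(** * Spans, independent sets and the exchange argument *)

Section Span.
Variable G : point_line_geometry.
Implicit Types (S T V X Y J : set (points G)).

Lemma span_subspace X : is_subspace (span X).
Proof.
move=> L lL [x [y [[Lx sx] [Ly sy] xy]]] z Lz S [Ssub XS].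
by apply: (Ssub L lL) => //; exists x, y; split => //; split => //;
  [apply: sx|apply: sy].
Qed.

Lemma sub_span X : X `<=` span X.
Proof. exact: sub_gen_smallest. Qed.

Lemma span_sub X S : is_subspace S -> X `<=` S -> span X `<=` S.
Proof. exact: smallest_sub. Qed.

Lemma span_mono X Y : X `<=` Y -> span X `<=` span Y.
Proof. by apply: sub_smallest2r; exact: span_subspace. Qed.

(** Two points of a line lying in the union already lie in the larger of two members. *)
Lemma bigcup_subspace (I : Type) (D : set I) (f : I -> set (points G)) :
  (forall i j, D i -> D j -> f i `<=` f j \/ f j `<=` f i) ->
  (forall i, D i -> is_subspace (f i)) ->
  is_subspace (\bigcup_(i in D) f i).
Proof.
move=> tot fS L lL [x [y [[Lx [i Di fx]] [Ly [j Dj fy]] xy]]].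
have [k Dk [fkx fky]] : exists2 k, D k & f k x /\ f k y.
  by case: (tot i j Di Dj) => ij; [exists j|exists i] => //; split => //; exact: ij.
move=> z Lz; exists k => //; apply: (fS k Dk L lL) => //.
by exists x, y; split.
Qed.

Lemma span_bigcup (I : Type) (D : set I) (f : I -> set (points G)) :
  (forall i j, D i -> D j -> f i `<=` f j \/ f j `<=` f i) ->
  span (\bigcup_(i in D) f i) `<=` \bigcup_(i in D) span (f i).
Proof.
move=> tot; apply: span_sub.
  apply: bigcup_subspace => [i j Di Dj|i _]; last exact: span_subspace.
  by case: (tot i j Di Dj) => /span_mono; [left|right].
by move=> x [i Di fx]; exists i => //; exact: sub_span.
Qed.

Definition independent J := forall x, J x -> ~ span (J `\ x) x.

Lemma independent_sub J X : independent J -> X `<=` J -> independent X.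
Proof.
move=> iJ XJ x Xx sx; apply: (iJ x (XJ _ Xx)).
by apply: span_mono sx => z [/XJ].
Qed.

(** By [span_bigcup] a dependency of [x] on the rest of the union occurs in one member, which can be
    enlarged to contain [x]. *)
Lemma independent_bigcup (I : Type) (D : set I) (f : I -> set (points G)) :
  (forall i j, D i -> D j -> f i `<=` f j \/ f j `<=` f i) ->
  (forall i, D i -> independent (f i)) ->
  independent (\bigcup_(i in D) f i).
Proof.
move=> tot fi x [i Di fx].
have -> : (\bigcup_(i in D) f i) `\ x = \bigcup_(i in D) (f i `\ x).
  by rewrite setD_bigcupl.
move=> /span_bigcup; case=> [j k Dj Dk|j Dj].
  by case: (tot j k Dj Dk) => jk; [left|right] => z [/jk].
case: (tot i j Di Dj) => ij; first by apply: fi => //; exact: ij.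
by move=> sx; apply: (fi i Di x fx); apply: span_mono sx => z [/ij].
Qed.

Hypothesis EP : exchange_property G.

(** If some [x] in [J] depended on [y] and the other points, (EP) would put [y] in the span of
    [J]. *)
Lemma independent_setU1 J y : independent J -> ~ span J y ->
  independent (J `|` [set y]).
Proof.
move=> iJ ny x [Jx|->].
  have xy : x <> y by move=> e; apply: ny; apply: sub_span; rewrite -e.
  have -> : (J `|` [set y]) `\ x = (J `\ x) `|` [set y].
    rewrite setDUl; congr (_ `|` _); apply/seteqP; split=> z; first by case.
    by move=> ->; split => // e; apply: xy.
  move=> sx; apply: ny; have := EP sx (iJ x Jx).
  by apply: span_mono => z [[]//|->].
by move=> sy; apply: ny; apply: span_mono sy => z [[]].
Qed.

(* Zorn on the graphs of partial injections from [J] to [Y] that, when used to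
   replace elements of [J] by their images, keep the set independent.  The condition that
   an image lying in [J] is itself replaced keeps images from colliding with
   elements that remain. *)
Lemma independent_card_le J Y : independent J -> generating Y -> J #<= Y.
Proof.
move=> iJ gY.
(* Since [swap g g] is not monotone in [g], the graph [D] of removals is a separate argument: for
   fixed [D], [swap D] commutes with unions of nonempty chains. *)
pose swap (D g : set (points G * points G)) :=
  [set x | J x /\ ~ (exists y, D (x, y))] `|` [set y | exists x, g (x, y)].
pose P g := [/\ forall x y, g (x, y) -> J x /\ Y y,
  forall x x' y, g (x, y) -> g (x', y) -> x = x',
  forall x y, g (x, y) -> J y -> exists z, g (y, z) & independent (swap g g)].
have [F FP Ftot|g [[gJY ginj gJ ig] gmax]] := @Zorn_bigcup _ P.
  have [F0|/set0P[g0 Fg0]] := eqVneq F set0.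
    rewrite F0 bigcup_set0; split => //.
    by apply: (independent_sub iJ) => x [[]//|[? []]].
  split.
  - by move=> x y [g Fg gxy]; have [+ _ _ _] := FP g Fg; exact.
  - move=> x x' y [g Fg gx] [h Fh hx].
    have [[_ ginj _ _] [_ hinj _ _]] := (FP _ Fg, FP _ Fh).
    by case: (Ftot g h Fg Fh) => gh; [apply: hinj hx; exact: gh
      |apply: ginj gx _; exact: gh].
  - move=> x y [g Fg gxy] Jy; have [_ _ /(_ _ _ gxy Jy)[z gz] _] := FP _ Fg.
    by exists z, g.
  set D := \bigcup_(X in F) X.
  have -> : swap D D = \bigcup_(g in F) swap D g.
    apply/seteqP; split=> [x [JDx|[y [g Fg gyx]]]|x [g Fg [JDx|[y gyx]]]].
    + by exists g0 => //; left.
    + by exists g => //; right; exists y.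
    + by left.
    + by right; exists y, g.
  apply: independent_bigcup => [g h Fg Fh|g Fg].
    by case: (Ftot g h Fg Fh) => gh; [left|right];
      move=> x [|[y /gh]]; [left|right; exists y|left|right; exists y].
  have [_ _ _ /independent_sub] := FP _ Fg; apply=> x [[Jx nD]|]; last by right.
  by left; split => // -[y gxy]; apply: nD; exists y, g.
(* A maximal [g] replaces all of [J]: otherwise an unreplaced [b] could be sent to some [y]. *)
have gdom b : J b -> exists y, g (b, y).
  move=> Jb; apply: contrapT => nb.
  have ib := independent_sub ig (@subDsetl _ (swap g g) [set b]).
  have gb : swap g g b by left.
  (* Otherwise the points other than [b] would span [Y], hence everything, [b] included. *)
  have [y Yy ny] : exists2 y, Y y & ~ span (swap g g `\ b) y.
    apply: contrapT => /forall2NP YS; apply: (ig b gb).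
    have: span Y b by rewrite gY.
    apply: span_sub; first exact: span_subspace.
    by move=> y Yy; case: (YS y) => // /contrapT.
  have yb : swap g g y -> y = b.
    by move=> gy; apply: contrapT => yb; apply: ny; apply: sub_span.
  have nrb x : ~ g (x, b) by move=> gxb; exact: nb (gJ _ _ gxb Jb).
  have nry x : ~ g (x, y).
    by move=> gxy; apply: (nrb x); rewrite -yb //; right; exists x.
  apply: (gmax (g `|` [set (b, y)])).
    split; first exact: subsetUl.
    by move=> gg; apply: nb; exists y; apply: gg; right.
  split.
  - by move=> x z [/gJY|[-> ->]].
  - move=> x x' z [gx|[-> zy]] [gx'|[-> zy']] //; first exact: ginj gx gx'.
      by move: gx; rewrite zy' => /nry.
    by move: gx'; rewrite zy => /nry.
  - move=> x z [gx|[_ zy]] Jz.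
      by have [w gw] := gJ _ _ gx Jz; exists w; left.
    have [[w gw]|nw] := pselect (exists w, g (y, w)).
      by exists w; left; rewrite zy.
    (* An unreplaced [y] in [J] must be [b] itself, which is then replaced by the new pair. *)
    rewrite zy in Jz *; have gy : swap g g y by left.
    by exists y; right; congr pair; exact: yb.
  apply: independent_sub (independent_setU1 ib ny) _.
  move=> x [[Jx nx]|[z [gz|[_ ->]]]]; last by right.
    left; split; last by move=> /= xb; apply: nx; exists y; right; rewrite xb.
    by left; split => // -[z gz]; apply: nx; exists z; left.
  left; split; first by right; exists z.
  by move=> /= xb; apply: (nrb z); rewrite -xb.
have /choice[f fP] : forall x, exists y, J x -> g (x, y).
  move=> x; have [/gdom[y]|nJ] := pselect (J x); first by exists y.
  by exists x.
apply: (@card_le_inj _ _ _ _ f) => [x /fP/gJY[]//|x x' /fP fx /fP fx' e].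
by apply: (ginj x x' (f x)) => //; rewrite e.
Qed.

Lemma rank_basis J : independent J -> generating J -> rank G = cardinal_of J.
Proof. by move=> iJ gJ; apply: rankE => // Y; exact: independent_card_le. Qed.

End Span.

(** * Closure properties of a maximal well ordered chain *)

Section MaximalChain.
Variables (G : point_line_geometry) (C : set (set (points G))).
Hypothesis Cmax : maximal_well_ordered_chain C.
Implicit Types (S T V : set (points G)).

Lemma max_chain_sub S : C S -> is_subspace S.
Proof. by case: Cmax => /well_ordered_chainP[+ _ _] _; exact. Qed.

Lemma max_chain_total S T : C S -> C T -> S `<=` T \/ T `<=` S.
Proof. by case: Cmax => /well_ordered_chainP[_ + _] _; exact. Qed.

Lemma max_chain_min (Q : set (points G) -> Prop) : (exists2 S, C S & Q S) ->
  exists S, [/\ C S, Q S & forall T, C T -> Q T -> S `<=` T].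
Proof.
move=> [S CS QS]; case: Cmax => /well_ordered_chainP[_ _ wo] _.
have [|| M [[CM QM] minM]] := wo (C `&` Q); [by move=> ? []|by exists S|].
by exists M; split => // T CT QT; exact: minM.
Qed.

(** Adjoining [V] keeps the chain well ordered: the least element of a subset is [V] or its least
    element in [C]. *)
Lemma max_chain_mem V : is_subspace V ->
  (forall T, C T -> T `<=` V \/ V `<=` T) -> C V.
Proof.
move=> sV cmpV; case: Cmax => _ /(_ (C `|` [set V])) <-; first by right.
  apply/well_ordered_chainP; split.
  - by move=> S [/max_chain_sub//|->].
  - move=> S T [CS|->] [CT|->]; [exact: max_chain_total|exact: cmpV| |by left].
    by case: (cmpV T CT); [right|left].
  - move=> D DC [S0 DS0].
    have [exC|nC] := pselect (exists2 S, C S & D S); last first.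
      have DV S : D S -> S = V.
        by move=> DS; case: (DC _ DS) => // CS; case: nC; exists S.
      by exists V; rewrite -{1}(DV S0) //; split => // T /DV ->.
    have [M [CM DM minM]] := max_chain_min exC.
    have [[DV VM]|nV] := pselect (D V /\ V `<=` M).
      exists V; split => // T DT; case: (DC _ DT) => [CT|-> //].
      exact: subset_trans VM (minM _ CT DT).
    exists M; split => // T DT; case: (DC _ DT) => [CT|TV]; first exact: minM.
    rewrite TV in DT *; case: (cmpV M CM) => // VM.
    by case: nV.
exact: subsetUl.
Qed.

Lemma max_chain_setT : C setT.
Proof. by apply: max_chain_mem => [L lL _|T _]; [|left]. Qed.

(** [Q] cuts out an initial segment; its members lie below the union, all others above it. *)
Lemma max_chain_bigcup (Q : set (points G) -> Prop) :
  (forall S T, C S -> C T -> Q S -> ~ Q T -> S `<=` T) ->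
  C (\bigcup_(S in C `&` Q) S).
Proof.
move=> Qdown; apply: max_chain_mem => [|T CT].
  apply: bigcup_subspace => [S T [CS _] [CT _]|S [CS _]].
    exact: max_chain_total.
  exact: max_chain_sub.
have [QT|nQT] := pselect (Q T); first by left=> x Tx; exists T.
by right=> x [S [CS QS] Sx]; exact: (Qdown S T).
Qed.

(* The second conjunct says that [x S] belongs to the successor of [S], since the
   members of [C] not included in [S] are those above the successor. *)
Definition picks_successor (x : set (points G) -> points G) :=
  forall S, C S -> S <> setT ->
    ~ S (x S) /\ forall T, C T -> T `<=` S \/ T (x S).

Lemma picks_successor_exists : exists x, picks_successor x.
Proof.
have [p0 _] := points_nonempty G.
suff /choice[x xP] : forall S, exists y, C S -> S <> setT ->
    ~ S y /\ forall T, C T -> T `<=` S \/ T y by exists x.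
move=> S.
have [[CS ST]|nS] := pselect (C S /\ S <> setT); last first.
  by exists p0 => CS ST; case: nS.
(* This [T] is the successor of [S]. *)
have [|T [CT nTS minT]] := max_chain_min (Q := fun T => ~ T `<=` S).
  by exists setT; [exact: max_chain_setT|rewrite subTset].
have [y [Ty nSy]] : exists y, T y /\ ~ S y.
  apply: contrapT => H; apply: nTS => y Ty; apply: contrapT => nSy.
  by apply: H; exists y.
exists y => _ _; split => // V CV.
have [|nVS] := pselect (V `<=` S); [by left|right; exact: minT Ty].
Qed.

(** * The picked points form a basis *)

Section Picks.
Variable x : set (points G) -> points G.
Hypothesis xP : picks_successor x.

Let B := x @` (C `\ setT).

Lemma picks_lt S T : C S -> S <> setT -> C T -> T (x S) -> S `<=` T.
Proof.
move=> CS ST CT Tx; case: (max_chain_total CS CT) => // TS.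
by have [[]] := xP CS ST; exact: TS.
Qed.

Lemma picks_inj S T : C S -> S <> setT -> C T -> T <> setT ->
  x S = x T -> S = T.
Proof.
move=> CS ST CT TT e; have [nS _] := xP CS ST; have [nT _] := xP CT TT.
apply/seteqP; split.
  by have [_ /(_ S CS)[//|]] := xP CT TT; rewrite -e.
by have [_ /(_ T CT)[//|]] := xP CS ST; rewrite e.
Qed.

Lemma max_chain_successor S : C S -> S <> setT -> C (span (S `|` [set x S])).
Proof.
move=> CS ST; apply: max_chain_mem => [|T CT]; first exact: span_subspace.
have [_ /(_ T CT)[TS|Tx]] := xP CS ST; [left|right].
  by move=> y /TS Sy; apply: sub_span; left.
apply: span_sub => [|y [|->//]]; first exact: max_chain_sub.
exact: picks_lt.
Qed.

Lemma picks_generating : generating B.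
Proof.
suff BT : forall T, C T -> T `<=` span B.
  by apply/seteqP; split => // y _; exact: (BT setT max_chain_setT).
apply: contrapT => /existsNP[T0 /not_implyP[CT0 nT0]].
have [|T [CT nTB minT]] := max_chain_min (Q := fun T => ~ T `<=` span B).
  by exists T0.
have [p [Tp nBp]] : exists p, T p /\ ~ span B p.
  apply: contrapT => H; apply: nTB => p Tp; apply: contrapT => nBp.
  by apply: H; exists p.
(* The largest member missing [p]. Its successor must contain [p], yet is spanned by [U] and [x U],
   both inside [span B]. *)
pose U := \bigcup_(S in C `&` (fun S => ~ S p)) S.
have CU : C U.
  apply: max_chain_bigcup => S V CS CV nSp /contrapT Vp.
  by case: (max_chain_total CS CV) => // /(_ _ Vp).
have nUp : ~ U p by case=> S [].
have UT : U <> setT by move=> e; apply: nUp; rewrite e.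
have UB : U `<=` span B.
  apply: contrapT => nUB; apply: nUp; exact: minT Tp.
have CU' := max_chain_successor CU UT.
have [U'p|nU'p] := pselect (span (U `|` [set x U]) p).
  apply: nBp; apply: span_sub U'p => [|y [/UB//|->]]; first exact: span_subspace.
  by apply: sub_span; exists U.
have [[]] := xP CU UT; exists (span (U `|` [set x U])) => //.
by apply: sub_span; right.
Qed.

Hypothesis EP : exchange_property G.

Lemma picks_independent : independent B.
Proof.
move=> _ [S [CS ST] <-] sB.
(* The least member in which the dependency of [x S] on other picks is visible. *)
have [|T [CT QT minT]] :=
  max_chain_min (Q := fun T => span ((B `&` T) `\ x S) (x S)).
  by exists setT; [exact: max_chain_setT|rewrite setIT].
pose W := \bigcup_(V in C `&` (fun V => ~ T `<=` V)) V.
have CW : C W.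
  apply: max_chain_bigcup => V V' CV CV' nTV /contrapT TV'.
  case: (max_chain_total CV CV') => // V'V.
  by case: nTV; exact: subset_trans V'V.
(* At a limit, the dependency would already occur in a smaller member. *)
have [TW|nTW] := pselect (T `<=` W).
  have : span (\bigcup_(V in C `&` (fun V => ~ T `<=` V)) ((B `&` V) `\ x S)) (x S).
    by apply: span_mono QT => y [[By /TW[V CV Vy]] yx]; exists V.
  case/span_bigcup => [V V' [CV _] [CV' _]|V [CV nTV] /(minT _ CV)//].
  by case: (max_chain_total CV CV') => VV'; [left|right];
    move=> y [[By /VV' Vy] yx].
have WT : W <> setT by move=> e; apply: nTW; rewrite e.
have [nWx _] := xP CW WT; have [nSx xSP] := xP CS ST.
(* Passing from [W] to [T] adds at most the pick [x W]. *)
have BT : (B `&` T) `\ x S `<=` ((B `&` W) `\ x S) `|` [set x W].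
  move=> _ [[[R [CR RT] <-] TxR] RS]; have [nRx xRP] := xP CR RT.
  have RW : R `<=` W by move=> y Ry; exists R => //; split => // /(_ _ TxR).
  case: (xRP _ CW) => [WR|WxR]; last by left; do !split => //; exists R.
  by right; congr x; apply/seteqP.
have nTS : ~ T `<=` S.
  move=> TS; apply: nSx; apply: span_sub QT => [|y [[_ /TS]]//].
  exact: max_chain_sub.
have SW : S `<=` W by move=> y Sy; exists S.
(* If [W] is [S], the excluded pick is [x W] and the dependency lies in [S]; otherwise (EP)
   exchanges [x S] with [x W] and puts [x W] in [W]. *)
case: (xSP _ CW) => [WS|WxS].
  have e : W = S by apply/seteqP.
  apply: nSx; apply: span_sub QT => [|y yBT]; first exact: max_chain_sub.
  case: (BT _ yBT) => [[[_ /WS]]//|/= yx].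
  by case: yBT => _; case; rewrite yx e.
apply: nWx; have: span (((B `&` W) `\ x S) `|` [set x S]) (x W).
  by apply: EP; [exact: span_mono QT|move=> /(minT _ CW)].
by apply: span_sub => [|y [[[]]//|->//]]; exact: max_chain_sub.
Qed.

Lemma rank_max_chain : rank G = cardinal_of (C `\ setT).
Proof.
rewrite (rank_basis EP picks_independent picks_generating).
apply/cardinal_of_eq; apply: inj_card_eq => S T.
rewrite !in_setE => -[CS ST] [CT TT]; exact: picks_inj.
Qed.

End Picks.

(** The whole space belongs to [C]; removing it subtracts one from a finite cardinal and leaves an
    infinite one unchanged. *)
Lemma chain_lengthE : chain_length C = cardinal_of (C `\ setT).
Proof.
rewrite /chain_length; case: asboolP => [Cfin|Cinf];
  apply/cardinal_of_eq; last first.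
  exact/card_esym/infinite_card_setD1.
have [n Cn] : finite_set (C `\ setT) by exact: finite_setD.
apply/card_esym; apply: (card_eq_trans Cn).
suff -> : #|` fset_set C|.-1 = n by [].
have := card_fset_set Cn; rewrite fset_setD1// => <-.
rewrite (cardfsD1 setT (fset_set C)) in_fset_set// mem_set//.
exact: max_chain_setT.
Qed.

End MaximalChain.

Theorem corollary3p6 (G : point_line_geometry) (C : set (set (points G))) :
  exchange_property G ->
  maximal_well_ordered_chain C ->
  chain_length C = rank G.
Proof.
move=> EP Cmax; have [x xP] := picks_successor_exists Cmax.
by rewrite (chain_lengthE Cmax) (rank_max_chain Cmax xP EP).
Qed.
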